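(* Let $a,b,c$ be pairwise coprime positive integers with $a<b<c$ and $a\mid b+c$, let $S=\langle a,b,c\rangle$, and let $k_1$ be the least positive integer with $k_1 b\in\langle a,c\rangle$. Put $d_{1,1}=c(a-k_1)$ and $d_{a,1}=b(k_1-1)$ (the first entries of rows $1$ and $a$ of the table below), and let $R_1(a,b,c)$ be the set of ideals $I$ of $S$ such that $d_{1,1}\in I$ or $d_{a,1}\in I$. Then \[I(a,b,c;q)=\frac{1}{1-q^a}\sum_{I\in R_1(a,b,c)}q^{\operatorname{codim}(I)}.\]
   Context: A non-empty set $I\subseteq S$ is an ideal of $S$ if $I+S\subseteq I$; its codimension is $\operatorname{codim}(I)=|S\setminus I|$; $I(a,b,c;q)=\sum_I q^{\operatorname{codim}(I)}$ over all ideals $I$ of $\langle a,b,c\rangle$. The table: for $i\in\{1,\ldots,a\}$, $j\geq1$, $d_{i,j}=c(a+1-k_1-i)+a(j-1)$ if $1\leq i\leq a-k_1$; $d_{i,j}=a(j-1)$ if $i=a-k_1+1$; $d_{i,j}=b(i+k_1-a-1)+a(j-1)$ if $a-k_1+2\leq i\leq a$. For an ideal $I$, $d_k(I)=|\{d_{k,j}:j\geq1\}\setminus I|$. In general the paper defines $R_k(a,b,c)$ as the ideals $I$ with $d_j(I)\geq k-1$ for all $j\in\{1,\ldots,a\}$ and with $d_{1,k}\in I$ or $d_{a,k}\in I$; for $k=1$ this is the set described in the claim. *)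

(* Defs.v *)
From HB Require Import structures.
From mathcomp Require Import all_boot all_order all_algebra finmap zify.
From mathcomp Require Import boolp classical_sets functions cardinality fsbigop.

Set Implicit Arguments.
Unset Strict Implicit.
Unset Printing Implicit Defensive.

Import GRing.Theory.
Local Open Scope classical_set_scope.
Local Open Scope ring_scope.

Definition fps (R : Type) : Type := nat -> R.

HB.instance Definition _ (R : Type) := gen_eqMixin (fps R).
HB.instance Definition _ (R : Type) := gen_choiceMixin (fps R).

Section FpsZmodule.
Variable R : zmodType.
Implicit Types f g : fps R.

Definition fps_zero : fps R := fun=> 0.
Definition fps_opp f : fps R := fun n => - f n.
Definition fps_add f g : fps R := fun n => f n + g n.

Fact fps_addA : associative fps_add.
Proof. by move=> f g h; apply/funext => n; rewrite /fps_add addrA. Qed.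
Fact fps_addC : commutative fps_add.
Proof. by move=> f g; apply/funext => n; rewrite /fps_add addrC. Qed.
Fact fps_add0 : left_id fps_zero fps_add.
Proof. by move=> f; apply/funext => n; rewrite /fps_add add0r. Qed.
Fact fps_addN : left_inverse fps_zero fps_opp fps_add.
Proof. by move=> f; apply/funext => n; rewrite /fps_add addNr. Qed.

HB.instance Definition _ :=
  GRing.isZmodule.Build (fps R) fps_addA fps_addC fps_add0 fps_addN.

Lemma coef_fpsD f g n : (f + g) n = f n + g n.
Proof. by []. Qed.
Lemma coef_fpsB f g n : (f - g) n = f n - g n.
Proof. by []. Qed.
End FpsZmodule.

Section FpsRing.
Variable R : comNzRingType.
Implicit Types f g h : fps R.

Definition fps_one : fps R := fun n => (n == 0%N)%:R.
Definition fps_mul f g : fps R := fun n => \sum_(i < n.+1) f i * g (n - i)%N.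

Let trunc m f : {poly R} := \poly_(i < m) f i.

Let coef_trunc m f n : (n < m)%N -> (trunc m f)`_n = f n.
Proof. by move=> nm; rewrite coef_poly nm. Qed.

Let fps_mulE m f g n : (n < m)%N -> fps_mul f g n = (trunc m f * trunc m g)`_n.
Proof.
move=> nm; rewrite coefM; apply: eq_bigr => i _.
rewrite !coef_trunc //; first exact: leq_ltn_trans (leq_subr _ _) nm.
exact: leq_trans (ltn_ord i) nm.
Qed.

Fact fps_mulC : commutative fps_mul.
Proof.
move=> f g; apply/funext => n.
by rewrite !(@fps_mulE n.+1) // mulrC.
Qed.

Fact fps_mulA : associative fps_mul.
Proof.
move=> f g h; apply/funext => n.
have E u v w : fps_mul u (fps_mul v w) n =
    (trunc n.+1 u * (trunc n.+1 v * trunc n.+1 w))`_n.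
  rewrite coefM; apply: eq_bigr => i _.
  rewrite coef_trunc; last exact: ltn_ord.
  by rewrite (@fps_mulE n.+1) // ltnS leq_subr.
by rewrite (fps_mulC (fps_mul f g)) !E mulrA mulrC.
Qed.

Fact fps_mul1 : left_id fps_one fps_mul.
Proof.
move=> f; apply/funext => n; rewrite /fps_mul big_ord_recl /= mul1r subn0.
by rewrite big1 ?addr0 // => i _; rewrite /fps_one /= mul0r.
Qed.

Fact fps_mulD : left_distributive fps_mul (@GRing.add (fps R)).
Proof.
move=> f g h; apply/funext => n; rewrite [RHS]coef_fpsD -big_split /=.
by apply: eq_bigr => i _; rewrite -mulrDl.
Qed.

Fact fps_one_neq0 : fps_one != 0.
Proof. by apply/eqP => /(congr1 (@^~ 0%N)) /eqP; rewrite oner_eq0. Qed.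

HB.instance Definition _ := GRing.Zmodule_isComNzRing.Build (fps R)
  fps_mulA fps_mulC fps_mul1 fps_mulD fps_one_neq0.

Definition fpsX : fps R := fun n => (n == 1%N)%:R.

Lemma coef_fpsM f g n : (f * g) n = \sum_(i < n.+1) f i * g (n - i)%N.
Proof. by []. Qed.

Lemma coef_fpsXn m n : (fpsX ^+ m) n = (n == m)%:R.
Proof.
elim: m n => [|m IH] n; first by [].
rewrite exprS coef_fpsM; case: n => [|n].
  by rewrite big_ord1 /fpsX /= mul0r.
rewrite big_ord_recl /fpsX /= mul0r add0r big_ord_recl /= mul1r IH.
rewrite big1 ?addr0 => [|i _]; last by rewrite /fpsX /= mul0r.
by rewrite subSS subn0.
Qed.
End FpsRing.

Section FpsUnitRing.
Variable R : comUnitRingType.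
Implicit Types f g : fps R.

Definition fps_unit : {pred fps R} := fun f => f 0%N \is a GRing.unit.

(* The first [n] coefficients of the inverse, obtained by solving
   [\sum_(i <= n) f_(n - i) g_i = (n == 0)] for [g_n]. *)
Fixpoint fps_inv_seq f (n : nat) : seq R :=
  if n is m.+1 then
    let s := fps_inv_seq f m in
    rcons s ((f 0%N)^-1 *
      ((m == 0%N)%:R - \sum_(i < m) f (m - i)%N * nth 0 s i))
  else [::].

Definition fps_inv f : fps R :=
  if f 0%N \is a GRing.unit then fun n => nth 0 (fps_inv_seq f n.+1) n else f.

Let size_inv_seq f n : size (fps_inv_seq f n) = n.
Proof. by elim: n => //= n IH; rewrite size_rcons IH. Qed.

Let nth_inv_seq f n i : (i < n)%N ->
  nth 0 (fps_inv_seq f n) i = nth 0 (fps_inv_seq f i.+1) i.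
Proof.
elim: n => // n IH; rewrite ltnS leq_eqVlt => /predU1P[-> //|lt_in].
by rewrite -IH //= nth_rcons size_inv_seq lt_in.
Qed.

Fact fps_mulV : {in fps_unit, left_inverse 1 fps_inv *%R}.
Proof.
move=> f uf; rewrite mulrC; apply/funext => n.
rewrite coef_fpsM (reindex_inj rev_ord_inj) /= big_ord_recr /= subnn subn0.
have := uf; rewrite /fps_inv unfold_in /fps_unit => ->.
rewrite [X in _ + _ * X]/= nth_rcons size_inv_seq ltnn eqxx mulVKr; last exact: uf.
rewrite addrC -[RHS](subrK (\sum_(i < n) f (n - i)%N * nth 0 (fps_inv_seq f n) i)).
congr (_ + _); apply: eq_bigr => i _.
have ni := ltn_ord i.
rewrite subSS subKn; last exact: ltnW.
by rewrite (@nth_inv_seq f n i).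
Qed.

Fact fps_unitPl f g : g * f = 1 -> fps_unit f.
Proof.
move=> /(congr1 (@^~ 0%N)); rewrite /= coef_fpsM big_ord1 /= => E.
by apply/unitrPr; exists (g 0%N); rewrite mulrC.
Qed.

Fact fps_inv_out : {in [predC fps_unit], fps_inv =1 id}.
Proof. by move=> f /negbTE; rewrite /fps_inv unfold_in /fps_unit => ->. Qed.

HB.instance Definition _ := GRing.ComNzRing_hasMulInverse.Build (fps R)
  fps_mulV fps_unitPl fps_inv_out.

Lemma unit_1BfpsXn m : (0 < m)%N -> (1 - fpsX R ^+ m) \is a GRing.unit.
Proof.
move=> m0; rewrite unfold_in /= /fps_unit.
by rewrite coef_fpsB coef_fpsXn; case: m m0 => // m _; rewrite subr0 unitr1.
Qed.
End FpsUnitRing.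

Notation "''q'" := (fpsX int) (at level 0) : ring_scope.

(* Coefficientwise sum of a family of power series; each coefficient is a
   finitely supported sum, so this is only meaningful for summable families
   (see [ideal_codim_finite]). *)
Definition fps_sum (R : zmodType) (T : choiceType) (A : set T) (F : T -> fps R)
  : fps R := fun n => \sum_(i \in A) F i n.

(* The submonoid of [nat] generated by the entries of [G]. *)
Definition semigroup (G : seq nat) : set nat :=
  [set x | exists u : nat -> nat, x = (\sum_(i < size G) u i * nth 0 G i)%N].

Definition is_ideal (S I : set nat) : Prop :=
  [/\ I !=set0, I `<=` S & forall x s, I x -> S s -> I (x + s)%N].

(* [fset_set] of an infinite set is empty, so this is the codimension only when
   [S `\` I] is finite; [ideal_setD_finite] shows that it is. *)
Definition codim (S I : set nat) : nat := #|` fset_set (S `\` I)|.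

Definition codim_series (S : set nat) (F : set (set nat)) : fps int :=
  fps_sum F (fun I => 'q ^+ codim S I).

Definition ideal_series (a b c : nat) : fps int :=
  let S := semigroup [:: a; b; c] in codim_series S (is_ideal S).

(* No truncation occurs: 1 <= k1 <= a for the least positive k1 with
   k1 * b in <a, c>, as a * b is in <a, c>. *)
Definition d11 (a c k1 : nat) : nat := (c * (a - k1))%N.
Definition da1 (b k1 : nat) : nat := (b * (k1 - 1))%N.

Definition R1 (a b c k1 : nat) : set (set nat) :=
  [set I | is_ideal (semigroup [:: a; b; c]) I /\
           (I (d11 a c k1) \/ I (da1 b k1))].

Lemma semigroup2P a b x :
  semigroup [:: a; b] x <-> exists u v, x = (u * a + v * b)%N.
Proof.
split=> [[u ->]|[u [v ->]]].
  by exists (u 0%N), (u 1%N); rewrite !big_ord_recl big_ord0 addn0.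
by exists (nth 0%N [:: u; v]); rewrite !big_ord_recl big_ord0 addn0.
Qed.

Lemma semigroup3P a b c x : semigroup [:: a; b; c] x <->
  exists u v w, x = (u * a + v * b + w * c)%N.
Proof.
split=> [[u ->]|[u [v [w ->]]]].
  by exists (u 0%N), (u 1%N), (u 2%N); rewrite !big_ord_recl big_ord0 addn0 addnA.
by exists (nth 0%N [:: u; v; w]); rewrite !big_ord_recl big_ord0 addn0 addnA.
Qed.

Lemma semigroup3_cofinite a b c x : (0 < a)%N -> coprime a b ->
  (a * b <= x)%N -> semigroup [:: a; b; c] x.
Proof.
move=> a0 cab abx; apply/semigroup3P.
case: (posnP b) cab abx => [->|b0 cab abx].
  by rewrite /coprime gcdn0 => /eqP -> _; exists x, 0%N, 0%N; rewrite muln1 !addn0.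
case: (egcdnP a b0) => km kn E _; rewrite gcdnC (eqP cab) in E.
pose r := ((x * km) %% a)%N.
have rbx : (r * b <= x)%N.
  by apply: leq_trans abx; rewrite leq_mul2r ltnW ?orbT // ltn_pmod.
have : (a %| x - r * b)%N.
  rewrite -eqn_mod_dvd // /r modnMml -mulnA E mulnDr muln1 mulnA.
  by rewrite -modnDml modnMl.
by case/dvdnP => u Eu; exists u, r, 0%N; rewrite addn0 -Eu subnK.
Qed.

Lemma ideal_setD_finite a b c I : (0 < a)%N -> coprime a b ->
  is_ideal (semigroup [:: a; b; c]) I ->
  finite_set (semigroup [:: a; b; c] `\` I).
Proof.
move=> a0 cab [[x Ix] _ Iadd].
apply: (@sub_finite_set _ _ `I_(x + a * b)); last exact: finite_II.
move=> y [_ nIy]; rewrite /mkset ltnNge; apply/negP => le_y; apply: nIy.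
have xy : (x <= y)%N by apply: leq_trans le_y; rewrite leq_addr.
rewrite -(subnKC xy); apply: Iadd => //; apply: semigroup3_cofinite => //.
by rewrite leq_subRL.
Qed.

Lemma ideal_codim_finite a b c n : (0 < a)%N -> coprime a b ->
  let S := semigroup [:: a; b; c] in
  finite_set [set I | is_ideal S I /\ codim S I = n].
Proof.
move=> a0 cab S; pose N := (a * b + a * b + n)%N.
pose F (A : {set 'I_N}) : set nat :=
  [set x | S x /\ ~ exists2 i : 'I_N, i \in A & x = i].
apply: (@sub_finite_set _ _ (F @` setT)); last exact/finite_image/finite_finset.
move=> I [idI codI]; have [_ IS Iadd] := idI.
have finD := ideal_setD_finite a0 cab idI.
have bnd x : S x -> ~ I x -> (x < N)%N.
  move=> Sx nIx; rewrite ltnNge; apply/negP => Nx.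
  have abx : (a * b + a * b <= x)%N by apply: leq_trans Nx; rewrite leq_addr.
  have /fsubset_leq_card : (seq_fset tt (iota (a * b) n.+1) `<=`
      fset_set (S `\` I))%fset.
    apply/fsubsetP => m; rewrite seq_fsetE mem_iota => /andP[lm mu].
    have mx : (m + a * b <= x)%N by rewrite /N in Nx; lia.
    rewrite in_fset_set // inE; split; first exact: semigroup3_cofinite.
    move=> Im; apply: nIx.
    have mx' : (m <= x)%N by apply: leq_trans mx; rewrite leq_addr.
    rewrite -(subnKC mx'); apply: Iadd => //; apply: semigroup3_cofinite => //.
    by rewrite leq_subRL.
  rewrite -/(codim S I) codI size_seq_fset undup_id ?iota_uniq // size_iota.
  by rewrite ltnn.
exists [set i : 'I_N | `[< ~ I i >]]%SET => //.
apply/seteqP; split=> x.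
  move=> [Sx nx]; apply: contrapT => nIx; apply: nx.
  by exists (Ordinal (bnd x Sx nIx)) => //; rewrite inE; apply/asboolP.
move=> Ix; split; first exact: IS.
by move=> [i]; rewrite inE => /asboolP nIi xi; apply: nIi; rewrite -xi.
Qed.

Lemma codim_seriesE S F n :
  codim_series S F n = \sum_(I \in [set I | F I /\ codim S I = n]) (1 : int).
Proof.
rewrite /codim_series /fps_sum.
under eq_fsbigr do rewrite coef_fpsXn.
rewrite [RHS](fsbig_mkcond (idx := 0)) [LHS](fsbig_mkcond (idx := 0)).
apply: eq_fsbigr => I _; rewrite /patch.
case: ifPn => [/set_mem FI|/negP nFI]; case: ifPn => //.
- by move=> /set_mem[_ <-]; rewrite eqxx.
- move=> /negP nI; case: eqP => // E; exfalso; apply: nI; apply/mem_set; split=> //.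
- by move=> /set_mem[FI _]; exfalso; apply: nFI; apply/mem_set.
Qed.

(* Main.v *)
(* As [a] divides [b + c], we have [k1 * b = u * a + (a - k1) * c] for some [u],
   and with the minimality of [k1] the elements of [S] outside [a + S] are the
   [v * b] with [v < k1] and the [w * c] with [w <= a - k1]. Adding multiples of
   [b] or [c], an ideal that contains one of them contains [da1] or [d11], the
   last ones. So the ideals outside [R1] are exactly the [a + J] with [J] an
   ideal, and since [codim (a + J) = codim J + a] they contribute
   [q^a * I(a,b,c;q)]. *)
Require Import Defs.
From mathcomp Require Import all_boot all_order all_algebra.
From mathcomp Require Import classical_sets.
From mathcomp Require Import finmap zify boolp functions cardinality fsbigop.

Import GRing.Theory.
Local Open Scope classical_set_scope.
Local Open Scope ring_scope.

Lemma coef_fpsXnM (R : comNzRingType) m (f : fps R) n :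
  (fpsX R ^+ m * f) n = if (n < m)%N then 0 else f (n - m)%N.
Proof.
rewrite coef_fpsM; under eq_bigr do rewrite coef_fpsXn.
case: ltnP => [nm|mn].
  apply: big1 => i _; case: eqP => [E|_]; last by rewrite mul0r.
  by have := ltn_ord i; rewrite E ltnS leqNgt nm.
have mn' : (m < n.+1)%N by [].
rewrite (bigD1 (Ordinal mn')) //= eqxx mul1r big1 ?addr0 // => i /negbTE ne.
by rewrite -(inj_eq val_inj) /= in ne; rewrite ne mul0r.
Qed.

(** * Translates of ideals and their codimension *)

Definition translate (a : nat) (J : set nat) : set nat := addn a @` J.

Lemma translate_inj a : injective (translate a).
Proof.
move=> J K E; apply/seteqP; split=> x Hx.
  have : translate a J (a + x)%N by exists x.
  by rewrite E => -[y Ky /addnI <-].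
have : translate a K (a + x)%N by exists x.
by rewrite -E => -[y Ky /addnI <-].
Qed.

Lemma semigroup3D a b c x y : semigroup [:: a; b; c] x ->
  semigroup [:: a; b; c] y -> semigroup [:: a; b; c] (x + y)%N.
Proof.
move=> /semigroup3P[u [v [w ->]]] /semigroup3P[u' [v' [w' ->]]].
by apply/semigroup3P; exists (u + u')%N, (v + v')%N, (w + w')%N; lia.
Qed.

Lemma is_ideal_translate a b c J :
  let S := semigroup [:: a; b; c] in
  is_ideal S J -> is_ideal S (translate a J).
Proof.
move=> S [[x Jx] JS JD]; split.
- by exists (a + x)%N, x.
- move=> _ [y /JS Sy <-]; apply: semigroup3D => //.
  by apply/semigroup3P; exists 1%N, 0%N, 0%N; lia.
- by move=> _ s [y Jy <-] Ss; exists (y + s)%N; [exact: JD | rewrite addnA].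
Qed.

(** Shifting [I] down by [a] keeps it closed under adding [S], and the result lies in [S] because
    [I] lies in [a + S]. *)
Lemma ideal_sub_translate S a I : is_ideal S I -> I `<=` translate a S ->
  exists2 J, is_ideal S J & I = translate a J.
Proof.
move=> [[x Ix] IS ID] IaS.
have E : I = translate a (addn a @^-1` I).
  apply/seteqP; split=> [y Iy|_ [y Iy <-] //].
  by have [z _ zy] := IaS _ Iy; exists z; rewrite // /preimage /= zy.
exists (addn a @^-1` I) => //; split.
- by have [z _ zx] := IaS _ Ix; exists z; rewrite /preimage /= zx.
- by move=> y /IaS[z Sz /addnI <-].
- by move=> y s Iy Ss; rewrite /preimage /= addnA; apply: ID.
Qed.

(** Turns codimension into a difference of counts below a common bound, written additively to avoid
    truncated subtraction. *)
Lemma codim_count (S I : set nat) N : I `<=` S ->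
  (forall x, (N <= x)%N -> S x -> I x) ->
  (codim S I + \sum_(0 <= x < N) `[< I x >] = \sum_(0 <= x < N) `[< S x >])%N.
Proof.
move=> IS IN.
have -> : codim S I = (\sum_(0 <= x < N) `[< (S `\` I) x >])%N.
  have finD : finite_set (S `\` I).
    apply: (@sub_finite_set _ _ `I_N); last exact: finite_II.
    move=> x [Sx nIx]; rewrite /mkset ltnNge; apply/negP => Nx.
    exact/nIx/IN.
  have -> : codim S I = size [seq x <- iota 0 N | `[< (S `\` I) x >]].
    apply/perm_size/uniq_perm; rewrite ?fset_uniq ?filter_uniq ?iota_uniq //.
    move=> x; rewrite mem_filter mem_iota /= add0n in_fset_set //.
    apply/idP/idP => [/set_mem Dx|/andP[/asboolP Dx _]]; last exact/mem_set.
    rewrite asboolT //= ltnNge; apply/negP => Nx.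
    by case: Dx => Sx; apply; apply: IN.
  by rewrite size_filter -sum1_count /index_iota subn0 big_mkcond.
rewrite -big_split; apply: eq_bigr => x _ /=; rewrite asbool_and asbool_neg.
case: (asboolP (I x)) => [Ix|_]; first by rewrite andbF asboolT //; apply: IS.
by rewrite andbT addn0.
Qed.

(** Below [a + N] the translate has as many elements as [J] has below [N], while [S] gains [a]
    elements, as [J] and hence [S] contain everything from [N] on. *)
Lemma codim_translate a b c J : (0 < a)%N -> coprime a b ->
  let S := semigroup [:: a; b; c] in
  is_ideal S J -> codim S (translate a J) = (codim S J + a)%N.
Proof.
move=> a0 cab S idJ; have [[x0 Jx0] JS JD] := idJ.
have Sbig x : (a * b <= x)%N -> S x by exact: semigroup3_cofinite.
(* [S] contains everything from [a * b] on, so [J] contains everything from [x0 + a * b] on. *)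
pose N := (x0 + a * b)%N.
have JN x : (N <= x)%N -> J x.
  by move=> Nx; rewrite -(@subnKC x0 x); [apply: JD => //; apply: Sbig|]; lia.
have EJ := @codim_count S J N JS (fun x Nx _ => JN x Nx).
have [_ aJS _] := @is_ideal_translate a b c J idJ.
have aJN x : (a + N <= x)%N -> S x -> translate a J x.
  by move=> Nx _; exists (x - a)%N; [apply: JN|]; lia.
have EaJ := @codim_count S (translate a J) (a + N) aJS aJN.
have SN : (\sum_(0 <= x < a + N) `[< S x >] =
    \sum_(0 <= x < N) `[< S x >] + a)%N.
  rewrite addnC (@big_cat_nat _ _ _ N) ?leq_addr //=; congr addn.
  rewrite (eq_big_nat _ _ (F2 := fun=> 1%N)).
    by rewrite sum_nat_const_nat; lia.
  by move=> x /andP[Nx _]; rewrite asboolT //; apply/JS/JN.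
have aJsum : (\sum_(0 <= x < a + N) `[< translate a J x >] =
    \sum_(0 <= x < N) `[< J x >])%N.
  rewrite (@big_cat_nat _ _ _ a) ?leq_addr //= big_nat big1 ?add0n.
    rewrite -{1}[a]add0n big_addn addKn; apply: eq_bigr => x _; congr nat_of_bool.
    apply/asboolP/asboolP => [[y Jy E]|Jx]; last by exists x; rewrite // addnC.
    by have -> : x = y by lia.
  move=> x /andP[_ xa]; rewrite asboolF // => -[y _ E].
  by rewrite -E ltnNge leq_addr in xa.
by move: EJ EaJ; rewrite SN aJsum; lia.
Qed.

(** * Elements of [S] outside [a + S], and the resulting splitting of the ideals *)

Section Apery.
Context (a b c k1 : nat).
Context (a_gt0 : (0 < a)%N) (a_lt_b : (a < b)%N) (b_lt_c : (b < c)%N)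
  (coprime_ab : coprime a b) (coprime_ac : coprime a c) (a_dvd_bc : (a %| b + c)%N)
  (k1_gt0 : (0 < k1)%N) (k1_mem : semigroup [:: a; c] (k1 * b)%N)
  (k1_min : forall k : nat,
     (0 < k)%N -> semigroup [:: a; c] (k * b)%N -> (k1 <= k)%N).
Let S := semigroup [:: a; b; c].

Lemma k1_le_a : (k1 <= a)%N.
Proof.
by apply: k1_min => //; apply/semigroup2P; exists b, 0%N; lia.
Qed.

(** Write [k1 * b = u * a + v * c]; then [v < k1] since [b < c]. Modulo [a], [c * (k1 + v)] equals
    [k1 * (b + c)], which vanishes, so [a] divides [k1 + v]. As [0 < k1 + v < 2 * a], the sum is
    [a]. *)
Lemma k1_relation : exists u, (k1 * b = u * a + (a - k1) * c)%N.
Proof.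
have [u [v E]] := (semigroup2P _ _ _).1 k1_mem.
exists u; rewrite E; congr (_ + _ * _)%N.
have vk : (v < k1)%N by nia.
have : (a %| c * (k1 + v))%N.
  have -> : (c * (k1 + v) = k1 * (b + c) - u * a)%N by nia.
  by apply: dvdn_sub; [exact: dvdn_mull | exact: dvdn_mull].
rewrite Gauss_dvdr // => /dvdnP[t Et].
have := k1_le_a; have -> : v = (t * a - k1)%N by lia.
move=> ka; have t1 : t = 1%N by nia.
by rewrite t1 mul1n.
Qed.

(** Otherwise [m * c = u.+1 * a + v * b] with [m <= a - k1]. Since [a] divides [b + c], it divides
    [m + v], so [v >= k1]; by [k1_relation] the right side then exceeds [(a - k1) * c]. *)
Lemma d11_notin_translate : ~ translate a S (d11 a c k1).
Proof.
move=> [x /semigroup3P[u [v [w ->]]]]; rewrite /d11 => E.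
have [m Em] : exists m, (m + w + k1 = a)%N.
  by exists (a - k1 - w)%N; have := k1_le_a; nia.
have Ec : (m * c = u.+1 * a + v * b)%N by nia.
have : (a %| b * (m + v))%N.
  rewrite -(@dvdn_addr (u.+1 * a)) ?dvdn_mull //.
  have -> : (u.+1 * a + b * (m + v) = m * (b + c))%N by nia.
  exact: dvdn_mull.
rewrite Gauss_dvdr // => /dvdn_leq le_a; have {}le_a : (a <= m + v)%N by apply: le_a; nia.
have [u' Eu] := k1_relation.
have le_bm : (k1 * b <= v * b)%N by rewrite leq_mul2r; lia.
have le_mc : (m * c <= (a - k1) * c)%N by rewrite leq_mul2r; lia.
lia.
Qed.

(** Otherwise cancelling [v * b] puts the smaller positive multiple [(k1 - 1 - v) * b] in the
    semigroup of [a] and [c]. *)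
Lemma da1_notin_translate : ~ translate a S (da1 b k1).
Proof.
move=> [x /semigroup3P[u [v [w ->]]]]; rewrite /da1 => E.
have lt_v : (v < k1 - 1)%N by nia.
have : (k1 <= k1 - 1 - v)%N.
  apply: k1_min; first by lia.
  by apply/semigroup2P; exists u.+1, w; nia.
by lia.
Qed.

Lemma outside_R1_sub_translate I : is_ideal S I ->
  ~ I (d11 a c k1) -> ~ I (da1 b k1) -> I `<=` translate a S.
Proof.
move=> [_ IS ID] nd11 nda1 x Ix.
have inS u v w y : (y = u.+1 * a + v * b + w * c)%N -> translate a S y.
  move=> ->; exists (u * a + v * b + w * c)%N; last by rewrite mulSn; lia.
  by apply/semigroup3P; exists u, v, w.
(* With [b + c = t.+1 * a], any element using both [b] and [c] lies in [a + S]. *)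
have [[//|t] Et] := dvdnP a_dvd_bc; first by lia.
have inSbc v w : translate a S (v.+1 * b + w.+1 * c)%N.
  by apply: (inS t v w); lia.
have [u [v [w Ex]]] := (semigroup3P _ _ _ _).1 (IS _ Ix).
case: u => [|u] in Ex; last exact: inS Ex.
case: v w => [|v] [|w] in Ex.
- case: nda1; rewrite /da1 -[(_ * _)%N]add0n; have -> : (0 = x)%N by lia.
  by apply: ID => //; apply/semigroup3P; exists 0%N, (k1 - 1)%N, 0%N; lia.
- have [le_w|lt_w] := leqP w.+1 (a - k1).
    case: nd11; have -> : d11 a c k1 = (x + (a - k1 - w.+1) * c)%N.
      by rewrite /d11 Ex; nia.
    by apply: ID => //; apply/semigroup3P; exists 0%N, 0%N, (a - k1 - w.+1)%N; lia.
  (* [r * c] is the first multiple of [c] beyond [d11]; [Er] is [r * (b + c) = r * t.+1 * a] with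
     [r * b] rewritten as [a * b - (k1 - 1) * b]. *)
  have le_ka := k1_le_a; pose r := (a - k1).+1.
  have Er : (r * c + b * a = (k1 - 1) * b + r * t.+1 * a)%N.
    by rewrite -mulnA -Et mulnDr; rewrite /r; nia.
  (* Either [Er] contradicts the minimality of [k1] (or [c > 0], when [k1 = 1]), or it puts [r * c],
     hence [x], in [a + S]. *)
  have [le_b|lt_b] := leqP (r * t.+1) b.
    have Ek : ((k1 - 1) * b = (b - r * t.+1) * a + r * c)%N by nia.
    have : (k1 <= k1 - 1)%N.
      apply: k1_min; last by apply/semigroup2P; exists (b - r * t.+1)%N, r.
      rewrite lt0n; apply/eqP => E0.
      have := leq_addl ((b - r * t.+1) * a) (r * c).
      by rewrite -Ek E0 mul0n leqn0 muln_eq0 /= -leqn0 leqNgt (leq_trans _ b_lt_c).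
    by move=> k1_le; exfalso; lia.
  apply: (inS (r * t.+1 - b.+1) (k1 - 1) (w.+1 - r))%N.
  have -> : ((r * t.+1 - b.+1).+1 = r * t.+1 - b)%N by lia.
  rewrite Ex (mulnBl _ _ a) (mulnBl _ _ c).
  have : (b * a <= r * t.+1 * a)%N by rewrite leq_mul2r; lia.
  have : (r * c <= w.+1 * c)%N by rewrite leq_mul2r; lia.
  lia.
- have [lt_v|le_v] := ltnP v.+1 k1.
    case: nda1; have -> : da1 b k1 = (x + (k1 - 1 - v.+1) * b)%N.
      by rewrite /da1 Ex; nia.
    by apply: ID => //; apply/semigroup3P; exists 0%N, (k1 - 1 - v.+1)%N, 0%N; lia.
  (* Trading [k1 * b] for [u * a + (a - k1) * c] puts [x] in [a + S], unless [u = 0] and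
     [v.+1 = k1], where [x] is [d11] itself. *)
  have [u Eu] := k1_relation.
  have Ex' : (x = u * a + (v.+1 - k1) * b + (a - k1) * c)%N by nia.
  case: u => [|u] in Eu Ex'; last exact: inS Ex'.
  case Ev: (v.+1 - k1)%N Ex' => [|v'] Ex'.
    by case: nd11; rewrite /d11 mulnC; have <- : x = ((a - k1) * c)%N by lia.
  case Ea: (a - k1)%N Ex' => [|a'] Ex'; first by nia.
  by rewrite Ex' mul0n add0n; exact: inSbc.
- by rewrite Ex mul0n add0n; exact: inSbc.
Qed.

Lemma ideals_split n :
  [set I | is_ideal S I /\ codim S I = n] =
  [set I | R1 a b c k1 I /\ codim S I = n] `|`
  [set translate a J | J in [set J | is_ideal S J /\ (codim S J + a)%N = n]].
Proof.
apply/seteqP; split=> [I [idI <-]|I [[[idI _] codI]|[J [idJ codJ] <-]]].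
- have [d11I|nd11] := pselect (I (d11 a c k1)); first by left; split=> //; split=> //; left.
  have [da1I|nda1] := pselect (I (da1 b k1)); first by left; split=> //; split=> //; right.
  right; have := outside_R1_sub_translate I idI nd11 nda1.
  move=> /(ideal_sub_translate S a I idI)[J idJ ->].
  by exists J => //; split=> //; rewrite (codim_translate a b c).
- by split.
- split; first exact: is_ideal_translate.
  by rewrite codim_translate.
Qed.
End Apery.

Theorem theorem4p3 (a b c k1 : nat)
    (a_gt0 : (0 < a)%N) (a_lt_b : (a < b)%N) (b_lt_c : (b < c)%N)
    (coprime_ab : coprime a b) (coprime_ac : coprime a c)
    (coprime_bc : coprime b c) (a_dvd_bc : (a %| b + c)%N)
    (k1_gt0 : (0 < k1)%N) (k1_mem : semigroup [:: a; c] (k1 * b)%N)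
    (k1_min : forall k : nat,
       (0 < k)%N -> semigroup [:: a; c] (k * b)%N -> (k1 <= k)%N) :
  ideal_series a b c =
    1 / (1 - 'q ^+ a) * codim_series (semigroup [:: a; b; c]) (R1 a b c k1).
Proof.
(* Clear the denominator, a unit, and compare coefficients. *)
have u1 := @unit_1BfpsXn int a a_gt0.
apply: (mulrI u1); rewrite mulrA mul1r mulrV // mul1r mulrBl mul1r.
apply/funext => n; rewrite coef_fpsB coef_fpsXnM /ideal_series.
have finI m : finite_set [set I | is_ideal (semigroup [:: a; b; c]) I /\
    codim (semigroup [:: a; b; c]) I = m].
  exact: ideal_codim_finite.
rewrite !codim_seriesE (@ideals_split a b c k1) // fsbigU //=.
- rewrite fsbig_image; last by move=> J K _ _; apply: translate_inj.
  rewrite -addrA -[RHS]addr0; congr (_ + _); apply/eqP; rewrite subr_eq0.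
  (* The translates must cancel the coefficient of [q^n] in [q^a * I(a,b,c;q)]; for [n < a] both are
     zero. *)
  case: ltnP => [na|an].
    by rewrite fsbig1 // => J [_ codJ]; exfalso; lia.
  apply/eqP; congr (\sum_(J \in _) _); apply/seteqP.
  by split=> J [idJ codJ]; split=> //; lia.
- by apply: sub_finite_set (finI n) => I [[idI _] codI].
- apply: finite_image; apply: sub_finite_set (finI (n - a)%N) => J [idJ codJ].
  by split=> //; lia.
(* Disjointness: a translate lies in [a + S], which contains neither [d11] nor [da1]. *)
- move=> I [[[_ R1I] _] [J [[_ JS _] _] EI]]; exfalso.
  have JaS := @image_subset _ _ (addn a) _ _ JS.
  case: R1I; rewrite -EI => /JaS.
    exact: (@d11_notin_translate a b c k1).
  exact: (@da1_notin_translate a b c k1).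
Qed.
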